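(* Consider the mirror transformation for the Calabi-Yau hypersurface $M_k^k$, i.e. the relation $$1+\sum_{d\ge1}L_n^{k,k,d}e^{dt}=\frac{\tilde L_n^{k,k}(e^{x(t)})}{\tilde L_1^{k,k}(e^{x(t)})}\qquad(n=2,\dots,k-3)$$ that expresses the structure constants $L_n^{k,k,d}$ of $M_k^k$ through its virtual structure constants $\tilde L_n^{k,k,d}$ and $\tilde L_1^{k,k,d}$. This mirror transformation is explicitly written as $$L^{k,k,d}_{n}=\sum_{m=0}^{d-1}\operatorname{Res}_{z=0}\Bigl(z^{-m-1}\exp\Bigl(-d\sum_{j=1}^{\infty}\frac{\tilde{L}_{1}^{k,k,j}}{j}z^{j}\Bigr)\Bigr)\cdot\bigl(\tilde{L}^{k,k,d-m}_{n}-\tilde{L}^{k,k,d-m}_{1}\bigr)\qquad(d\ge1).$$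
   Context: $M_N^k$ is a degree $k$ hypersurface in $CP^{N-1}$, $e$ is its Kähler (hyperplane) class, and $L_m^{N,k,d}=\frac1k\langle\mathcal O_e\mathcal O_{e^{N-2-m}}\mathcal O_{e^{m-1-(k-N)d}}\rangle_{d,M_N^k}$ (genus $0$, degree $d$ Gromov-Witten invariant) are the structure constants of the subring of the quantum cohomology ring generated by $\mathcal O_e$. Virtual structure constants: when $N-k\ge2$, the constants $L_m^{N,k,d}$ are obtained from the $L_{m'}^{N+1,k,d'}$ ($d'\le d$) by recursion relations, weighted homogeneous of degree $d$. For $d=1,2,3$ these are (writing $L_m^{d}$ for $L_m^{N+1,k,d}$ on the right): $L_m^{N,k,1}=L_m^1$; $L_m^{N,k,2}=\frac12(L_{m-1}^2+L_m^2+2L_m^1L_{m+(N-k)}^1)$; $L_m^{N,k,3}=\frac1{18}(4L_{m-2}^3+10L_{m-1}^3+4L_m^3+12L_{m-1}^2L_{m+2(N-k)}^1+9L_m^2L_{m+2(N-k)}^1+6L_m^2L_{m+1+2(N-k)}^1+6L_{m-1}^1L_{m-1+(N-k)}^2+9L_m^1L_{m-1+(N-k)}^2+12L_m^1L_{m+(N-k)}^2+18L_m^1L_{m+(N-k)}^1L_{m+2(N-k)}^1)$; and there are analogous relations for higher $d$. The virtual structure constant $\tilde L_m^{N,k,d}$ is the rational number obtained by applying these same recursion relations for arbitrary $N$ and $k$, descending in $N$, starting from the initial conditions in the region $N\ge2k$: $\tilde L_m^{N,k,1}=L_m^{N,k,1}$ (there independent of $N$ and nonzero only for $0\le m\le k-1$)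 and $\tilde L_m^{N,k,d}=0$ for $d\ge2$. Put $\tilde L_n^{k,k}(z)=1+\sum_{d\ge1}\tilde L_n^{k,k,d}z^d$ for $n=0,\dots,k-1$. The mirror map is $t(x)=x+\sum_{d\ge1}\frac{\tilde L_1^{k,k,d}}{d}e^{dx}$, and $x(t)$ is its inverse. All identities are between formal power series, and $\operatorname{Res}_{z=0}(z^{-m-1}g(z))$ is the coefficient of $z^m$ in $g(z)$. *)

(* Defs.v *)
(* MathComp world. *)
From mathcomp Require Import all_boot all_order all_algebra.
Set Implicit Arguments.
Unset Strict Implicit.
Unset Printing Implicit Defensive.
Import Order.TTheory GRing.Theory Num.Theory.
Local Open Scope ring_scope.

(** * Formal power series over rat *)

(* [a n] is the coefficient of z^n, i.e. Res_{z=0} (z^{-n-1} a(z)). *)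
Definition fps := nat -> rat.

Definition one_plus (a : nat -> rat) : fps :=
  fun d => if d is 0 then 1 else a d.

Definition fps_one : fps := one_plus (fun=> 0).

Definition fps_add (a b : fps) : fps := fun n => a n + b n.

Definition fps_scale (c : rat) (a : fps) : fps := fun n => c * a n.

Definition fps_mul (a b : fps) : fps :=
  fun n => \sum_(i < n.+1) a i * b (n - i)%N.

Definition fps_pow (a : fps) (i : nat) : fps := iter i (fps_mul a) fps_one.

(* a(b(z)).  Only meaningful when [b 0 = 0], in which case the powers b^i with
   i > n do not contribute to the coefficient of z^n. *)
Definition fps_comp (a b : fps) : fps :=
  fun n => \sum_(i < n.+1) a i * fps_pow b i n.

(* exp(a(z)).  Only meaningful when [a 0 = 0]. *)
Definition fps_exp (a : fps) : fps := fps_comp (fun i => i`!%:R^-1) a.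

(* 1 / b = b_0^{-1} * sum_i (1 - b / b_0)^i; requires [b 0 != 0]. *)
Definition fps_inv (b : fps) : fps :=
  fps_scale (b 0%N)^-1
    (fps_comp (fun=> 1) (fps_add fps_one (fps_scale (- (b 0%N)^-1) b))).

Definition fps_div (a b : fps) : fps := fps_mul a (fps_inv b).

(** * Changes of variable s |-> s + sum_{d >= 1} f_d e^{ds} *)

(* Such a change of variable is represented by the series f with [f 0 = 0].
   In the variable e^s, its exponential e^{s + f(e^s)} is the series
   e^s * exp(f(e^s)). *)
Definition exp_of_change (f : fps) : fps :=
  fun n => if n is n'.+1 then fps_exp f n' else 0.

(* (s + f(e^s)) o (s + g(e^s)) = s + (g(e^s) + f(e^{s + g(e^s)})). *)
Definition change_comp (f g : fps) : fps :=
  fps_add g (fps_comp f (exp_of_change g)).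

Definition change_inverse (f g : fps) : Prop :=
  [/\ g 0%N = 0,
      forall n, change_comp f g n = 0
    & forall n, change_comp g f n = 0].

(** * Virtual structure constants *)

(* A family L_m^{N,k,d} is written [L N k d m]. *)
Definition constants := nat -> nat -> nat -> int -> rat.

(* The properties of the degree 1 constants in the region N >= 2k. *)
Definition stable_range (L : constants) (k : nat) : Prop :=
  forall (N : nat) (m : int), (2 * k <= N)%N ->
    L N k 1%N m = L (2 * k)%N k 1%N m /\
    (~~ (0 <= m < k%:Z) -> L N k 1%N m = 0).

(* A relation expressing L_m^{N,k,d} through the M_{m'}^{d'} = L_{m'}^{N+1,k,d'}
   as a rational linear combination of products: the term
   (c, [:: (d_1, s_1); ...; (d_l, s_l)]) stands for
     c * prod_j M_{m + s_j + (d_1 + ... + d_{j-1})(N-k)}^{d_j}. *)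
Definition relation := seq (rat * seq (nat * int)).

Definition homogeneous (d : nat) (r : relation) : bool :=
  all (fun t => all (fun p => 0 < p.1)%N t.2 && (sumn (unzip1 t.2) == d)) r.

(* [c] accumulates d_1 + ... + d_{j-1}, and [h] is N - k. *)
Fixpoint eval_product (h : int) (M : nat -> int -> rat) (m : int) (c : nat)
    (t : seq (nat * int)) : rat :=
  if t is (d, s) :: t' then
    M d (m + s + c%:Z * h) * eval_product h M m (c + d) t'
  else 1.

Definition eval_relation (h : int) (M : nat -> int -> rat) (m : int)
    (r : relation) : rat :=
  \sum_(t <- r) t.1 * eval_product h M m 0 t.2.

(* The relation of degree d; those of degree d >= 4 are supplied by
   [higher d].  The value at d = 0 is irrelevant. *)
Definition descend (higher : nat -> relation) (N k : nat)
    (M : nat -> int -> rat) (d : nat) (m : int) : rat :=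
  let h := N%:Z - k%:Z in
  match d with
  | 0 => 0
  | 1 => M 1%N m
  | 2 => 2^-1 * (M 2%N (m - 1) + M 2%N m + 2 * M 1%N m * M 1%N (m + h))
  | 3 => 18^-1 *
      (4 * M 3%N (m - 2) + 10 * M 3%N (m - 1) + 4 * M 3%N m
       + 12 * M 2%N (m - 1) * M 1%N (m + 2 * h)
       + 9 * M 2%N m * M 1%N (m + 2 * h)
       + 6 * M 2%N m * M 1%N (m + 1 + 2 * h)
       + 6 * M 1%N (m - 1) * M 2%N (m - 1 + h)
       + 9 * M 1%N m * M 2%N (m - 1 + h)
       + 12 * M 1%N m * M 2%N (m + h)
       + 18 * M 1%N m * M 1%N (m + h) * M 1%N (m + 2 * h))
  | _ => eval_relation h M m (higher d)
  end.

Definition initial (L : constants) (N k d : nat) (m : int) : rat :=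
  if d == 1%N then L N k 1%N m else 0.

(* [j] is the number of steps from N up to the region N >= 2k. *)
Fixpoint virtual_rec (L : constants) (higher : nat -> relation) (k j N : nat)
    : nat -> int -> rat :=
  if j is j'.+1 then descend higher N k (virtual_rec L higher k j' N.+1)
  else initial L N k.

Definition virtual (L : constants) (higher : nat -> relation) : constants :=
  fun N k => virtual_rec L higher k (2 * k - N)%N N.

(** * The Calabi-Yau case N = k *)

Definition virtual_series (L : constants) (higher : nat -> relation)
    (k n : nat) : fps :=
  one_plus (fun d => virtual L higher k k d n%:Z).

(* sum_{j >= 1} a_j / j * z^j. *)
Definition log_series (a : nat -> rat) : fps :=
  fun j => if j is 0 then 0 else a j / j%:R.

(* The mirror map t(x), as a change of variable. *)
Definition mirror_map (L : constants) (higher : nat -> relation) (k : nat)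
    : fps :=
  log_series (fun d => virtual L higher k k d 1).

(* Here x(t) = t + sum_{d >= 1} xi_d e^{dt}, and both sides are series in
   e^t. *)
Definition mirror_transformation (L : constants) (higher : nat -> relation)
    (k : nat) (xi : fps) (n : nat) : Prop :=
  forall d, one_plus (fun d' => L k k d' n%:Z) d =
    fps_div (fps_comp (virtual_series L higher k n) (exp_of_change xi))
            (fps_comp (virtual_series L higher k 1) (exp_of_change xi)) d.

(* Main.v *)
(** Write [f = sum_j a_j/j z^j], [A = 1 + sum_j a_j z^j] and
    [phi(z) = z exp(f(z))], so that [A = 1 + z f'] and the exponential of
    the inverse change of variable is the compositional inverse of [phi].  If
    [G = (B/A) o phi^{-1}], then [B = A * sum_j G_j z^j exp(j f)].  Hence the
    coefficient of [z^d] in [B exp(-d f)] is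
    [sum_j G_j [z^{d-j}] (1 + z f') exp(-(d-j) f)].  For [r = d - j > 0] we have
    [(1 + z f') exp(-r f) = h - z h'/r] with [h = exp(-r f)], whose coefficient
    of [z^r] vanishes; so only [G_d] survives.  This is Lagrange inversion.
    Taking [B = A] shows that [B] may be replaced by [B - A] when [d > 0]. *)
Require Import Defs.
From mathcomp Require Import all_boot all_order all_algebra.
From mathcomp Require Import ring.
From Stdlib Require Import FunctionalExtensionality.
Import Order.TTheory GRing.Theory Num.Theory.
Local Open Scope ring_scope.

Implicit Types (a b f g : fps) (p q : {poly rat}).

(** * Truncation to polynomials *)

(* Identities between series are proved coefficientwise, by transporting them
   from the ring of polynomials. *)
Definition represents (N : nat) (p : {poly rat}) (a : fps) : Prop :=
  forall i, (i <= N)%N -> p`_i = a i.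

Definition truncate (N : nat) (a : fps) : {poly rat} := \poly_(i < N.+1) a i.

Lemma represents_truncate N a : represents N (truncate N a) a.
Proof. by move=> i le_iN; rewrite coef_poly ltnS le_iN. Qed.

(** The witness may change with [N], so a ring identity between truncations in [{poly rat}] proves
    the corresponding identity of series. *)
Lemma fps_eq_poly (a b : fps) :
  (forall N, exists2 p, represents N p a & represents N p b) -> a = b.
Proof.
move=> eq_ab; apply: functional_extensionality => N.
by have [p pa pb] := eq_ab N; rewrite -pa // pb.
Qed.

Lemma represents_one N : represents N 1 fps_one.
Proof. by move=> [|i] _; rewrite coef1. Qed.

Lemma represents_mul N p q a b :
  represents N p a -> represents N q b -> represents N (p * q) (fps_mul a b).
Proof.
move=> pa qb i le_iN; rewrite coefM; apply: eq_bigr => j _.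
rewrite pa ?qb //; first exact: leq_trans (leq_subr _ _) le_iN.
by apply: leq_trans le_iN; rewrite -ltnS.
Qed.

Lemma represents_pow N p a i :
  represents N p a -> represents N (p ^+ i) (fps_pow a i).
Proof.
move=> pa; elim: i => [|i IHi]; first exact: represents_one.
by rewrite exprS; apply: represents_mul.
Qed.

(** Divisibility of [b] by z makes its i-th power divisible by z^i. *)
Lemma fps_pow_small (b : fps) i n : b 0%N = 0 -> (n < i)%N -> fps_pow b i n = 0.
Proof.
move=> b0; elim: i n => // i IHi n lt_ni; rewrite /= /fps_mul.
apply: big1 => -[[|j] /= lt_jn] _; first by rewrite b0 mul0r.
by rewrite IHi ?mulr0 // ltn_subLR // (leq_trans lt_ni) // addSn ltnS leq_addl.
Qed.

(** A summation bound independent of [n] is what later allows sums to be exchanged. *)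
Lemma fps_comp_widen (a b : fps) n N :
  b 0%N = 0 -> (n <= N)%N ->
  fps_comp a b n = \sum_(i < N.+1) a i * fps_pow b i n.
Proof.
move=> b0 le_nN.
rewrite /fps_comp (big_ord_widen N.+1 (fun i => a i * fps_pow b i n)) //.
rewrite big_mkcond; apply: eq_bigr => i _; case: ifPn => //.
by rewrite -leqNgt => lt_ni; rewrite fps_pow_small ?mulr0.
Qed.

Lemma represents_comp N p q a b :
  b 0%N = 0 -> represents N p a -> represents N q b ->
  represents N (p \Po q) (fps_comp a b).
Proof.
move=> b0 pa qb n le_nN.
(* The degree of [p] may exceed [N]; its coefficients beyond [N] are arbitrary, but they multiply
   powers of [b] that vanish up to order [N]. *)
pose M := maxn N.+1 (size p).
have le_NM : (N.+1 <= M)%N by rewrite leq_maxl.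
have -> : p \Po q = \sum_(i < M) p`_i *: q ^+ i.
  rewrite comp_polyE (big_ord_widen M (fun i => p`_i *: q ^+ i)) ?leq_maxr //.
  rewrite big_mkcond; apply: eq_bigr => i _; case: ifPn => //.
  by rewrite -leqNgt => /(nth_default 0) ->; rewrite scale0r.
rewrite (fps_comp_widen _ _ _ N) // coef_sum.
rewrite (big_ord_widen M (fun i => a i * fps_pow b i n)) //.
rewrite [RHS]big_mkcond; apply: eq_bigr => i _; rewrite coefZ (represents_pow N _ b) //.
case: ifPn => [lt_iN|]; first by rewrite pa.
by rewrite -leqNgt => lt_Ni; rewrite fps_pow_small ?mulr0 // (leq_ltn_trans le_nN).
Qed.

(** * Algebra of power series *)

Lemma fps_mulC : commutative fps_mul.
Proof.
move=> a b; apply: fps_eq_poly => N; exists (truncate N a * truncate N b).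
  by apply: represents_mul; apply: represents_truncate.
by rewrite mulrC; apply: represents_mul; apply: represents_truncate.
Qed.

Lemma fps_mulA : associative fps_mul.
Proof.
move=> a b c; apply: fps_eq_poly => N.
exists (truncate N a * (truncate N b * truncate N c)).
  by do ?apply: represents_mul; apply: represents_truncate.
by rewrite mulrA; do ?apply: represents_mul; apply: represents_truncate.
Qed.

Lemma fps_mul1 : left_id fps_one fps_mul.
Proof.
move=> a; apply: fps_eq_poly => N; exists (1 * truncate N a).
  apply: represents_mul; [exact: represents_one | exact: represents_truncate].
by rewrite mul1r; apply: represents_truncate.
Qed.

Lemma fps_mulDl : left_distributive fps_mul fps_add.
Proof.
move=> a b c; apply: functional_extensionality => n.
by rewrite /fps_mul /fps_add -big_split; apply: eq_bigr => i _; rewrite mulrDl.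
Qed.

Lemma fps_scale_mull c a b : fps_mul (fps_scale c a) b = fps_scale c (fps_mul a b).
Proof.
apply: functional_extensionality => n; rewrite /fps_mul /fps_scale mulr_sumr.
by apply: eq_bigr => i _; rewrite mulrA.
Qed.

Lemma fps_scale_scale c c' a : fps_scale c (fps_scale c' a) = fps_scale (c * c') a.
Proof. by apply: functional_extensionality => n; rewrite /fps_scale mulrA. Qed.

Lemma fps_scale1 a : fps_scale 1 a = a.
Proof. by apply: functional_extensionality => n; rewrite /fps_scale mul1r. Qed.

Lemma fps_pow_mul a b i : fps_pow (fps_mul a b) i = fps_mul (fps_pow a i) (fps_pow b i).
Proof.
apply: fps_eq_poly => N; exists ((truncate N a * truncate N b) ^+ i).
  by apply/represents_pow/represents_mul; apply: represents_truncate.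
by rewrite exprMn; apply: represents_mul; apply/represents_pow/represents_truncate.
Qed.

Lemma fps_pow_scale c a i : fps_pow (fps_scale c a) i = fps_scale (c ^+ i) (fps_pow a i).
Proof.
elim: i => [|i IHi]; first by rewrite fps_scale1.
rewrite /= -/(fps_pow _ i) IHi fps_scale_mull fps_mulC fps_scale_mull.
by rewrite fps_scale_scale fps_mulC -exprS.
Qed.

Definition fps_X : fps := fun n => (n == 1%N)%:R.

Lemma represents_X N : represents N 'X fps_X.
Proof. by move=> i _; rewrite coefX. Qed.

Lemma fps_mulX a n : fps_mul fps_X a n = if n is n'.+1 then a n' else 0.
Proof.
rewrite -(represents_mul n _ _ _ _ (represents_X n) (represents_truncate n a)) //.
by rewrite coefXM; case: n => // n; rewrite represents_truncate.
Qed.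

Lemma fps_mul_powX j a n :
  fps_mul (fps_pow fps_X j) a n = if (n < j)%N then 0 else a (n - j)%N.
Proof.
rewrite -(represents_mul n _ _ _ _ (represents_pow _ _ _ j (represents_X n))
            (represents_truncate n a)) //.
by rewrite coefXnM; case: ifP => // _; rewrite represents_truncate ?leq_subr.
Qed.

Lemma fps_comp_mul a b c :
  c 0%N = 0 -> fps_comp (fps_mul a b) c = fps_mul (fps_comp a c) (fps_comp b c).
Proof.
move=> c0; apply: fps_eq_poly => N.
exists ((truncate N a * truncate N b) \Po truncate N c).
  by apply: represents_comp => //; do ?apply: represents_mul;
     apply: represents_truncate.
by rewrite comp_polyM; apply: represents_mul; apply: represents_comp => //;
   apply: represents_truncate.
Qed.

Lemma fps_compA a b c :
  b 0%N = 0 -> c 0%N = 0 -> fps_comp (fps_comp a b) c = fps_comp a (fps_comp b c).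
Proof.
move=> b0 c0; apply: fps_eq_poly => N.
exists (truncate N a \Po truncate N b \Po truncate N c).
  by do ?apply: represents_comp => //; apply: represents_truncate.
rewrite -comp_polyA; do ?apply: represents_comp => //; try exact: represents_truncate.
by rewrite /fps_comp big_ord1 b0 mul0r.
Qed.

Lemma fps_comp1 c : c 0%N = 0 -> fps_comp fps_one c = fps_one.
Proof.
move=> c0; apply: fps_eq_poly => N; exists (1 \Po truncate N c).
  apply: represents_comp => //; [exact: represents_one | exact: represents_truncate].
by rewrite comp_polyC; apply: represents_one.
Qed.

Lemma fps_comp_Xl c : c 0%N = 0 -> fps_comp fps_X c = c.
Proof.
move=> c0; apply: fps_eq_poly => N; exists ('X \Po truncate N c).
  apply: represents_comp => //; [exact: represents_X | exact: represents_truncate].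
by rewrite comp_polyX; apply: represents_truncate.
Qed.

Lemma fps_comp_Xr a : fps_comp a fps_X = a.
Proof.
apply: fps_eq_poly => N; exists (truncate N a \Po 'X).
  apply: represents_comp => //; [exact: represents_truncate | exact: represents_X].
by rewrite comp_polyXr; apply: represents_truncate.
Qed.

Lemma fps_comp_add a b c : fps_comp (fps_add a b) c = fps_add (fps_comp a c) (fps_comp b c).
Proof.
apply: functional_extensionality => n.
by rewrite /fps_comp /fps_add -big_split; apply: eq_bigr => i _; rewrite mulrDl.
Qed.

Lemma fps_comp_scale x a c : fps_comp (fps_scale x a) c = fps_scale x (fps_comp a c).
Proof.
apply: functional_extensionality => n; rewrite /fps_comp /fps_scale mulr_sumr.
by apply: eq_bigr => i _; rewrite mulrA.
Qed.

(** With u = 1 - b/b_0, both factors are series in u: b/b_0 = 1 - u, and the inverse is b_0^{-1}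
    times the geometric series in u. The claim reduces to (1 - z) sum_i z^i = 1. *)
Lemma fps_mul_inv b : b 0%N != 0 -> fps_mul (fps_inv b) b = fps_one.
Proof.
move=> b0; rewrite /fps_inv; set u := fps_add _ _.
have u0 : u 0%N = 0 by rewrite /u /fps_add /fps_scale mulNr mulVf // subrr.
have def_b : fps_scale (b 0%N)^-1 b = fps_comp (fps_add fps_one (fps_scale (-1) fps_X)) u.
  rewrite fps_comp_add fps_comp_scale fps_comp1 // fps_comp_Xl //.
  by apply: functional_extensionality => n; rewrite /u /fps_add /fps_scale; ring.
rewrite fps_scale_mull fps_mulC -fps_scale_mull def_b -fps_comp_mul //.
rewrite fps_mulDl fps_mul1 fps_scale_mull -[RHS](fps_comp1 u) //.
congr fps_comp; apply: functional_extensionality => n.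
by rewrite /fps_add /fps_scale fps_mulX; case: n => [|n] /=; ring.
Qed.

(** * Exponentials *)

(** This is exp(cz). Moving the scalar into the outer series reduces the laws of exponents to
    identities between these series. *)
Definition exp_series (c : rat) : fps := fun i => c ^+ i / i`!%:R.

Lemma fps_exp_scale c f : fps_exp (fps_scale c f) = fps_comp (exp_series c) f.
Proof.
apply: functional_extensionality => n; apply: eq_bigr => i _.
by rewrite fps_pow_scale /exp_series /fps_scale; ring.
Qed.

Lemma exp_series_mul c c' : fps_mul (exp_series c) (exp_series c') = exp_series (c + c').
Proof.
apply: functional_extensionality => n.
rewrite /fps_mul /exp_series addrC exprDn mulr_suml; apply: eq_bigr => i _.
have le_in : (i <= n)%N by rewrite -ltnS.
have fact0 m : m`!%:R != 0 :> rat by rewrite pnatr_eq0 -lt0n fact_gt0.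
(* The binomial theorem divided by n!, with n! = C(n,i) i! (n-i)!. *)
rewrite -mulr_natr -(bin_fact le_in) !natrM.
have bin0 : 'C(n, i)%:R != 0 :> rat by rewrite pnatr_eq0 -lt0n bin_gt0.
by field; rewrite !fact0 bin0.
Qed.

Lemma fps_exp_mul c c' f :
  f 0%N = 0 ->
  fps_mul (fps_exp (fps_scale c f)) (fps_exp (fps_scale c' f))
  = fps_exp (fps_scale (c + c') f).
Proof. by move=> f0; rewrite !fps_exp_scale -fps_comp_mul // exp_series_mul. Qed.

Lemma fps_exp_scale0 f : f 0%N = 0 -> fps_exp (fps_scale 0 f) = fps_one.
Proof.
move=> f0; rewrite fps_exp_scale -[RHS](fps_comp1 f) //; congr fps_comp.
by apply: functional_extensionality => -[|i];
   rewrite /exp_series ?expr0n ?mul0r ?fact0 ?divr1.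
Qed.

Lemma fps_exp_pow f j : f 0%N = 0 -> fps_pow (fps_exp f) j = fps_exp (fps_scale j%:R f).
Proof.
move=> f0; elim: j => [|j IHj]; first by rewrite fps_exp_scale0.
by rewrite /= -/(fps_pow _ j) IHj -{1}[f]fps_scale1 fps_exp_mul // -nat1r.
Qed.

Lemma fps_exp_comp f c :
  f 0%N = 0 -> c 0%N = 0 -> fps_comp (fps_exp f) c = fps_exp (fps_comp f c).
Proof. by move=> f0 c0; rewrite fps_compA. Qed.

(** The operator z d/dz, which unlike d/dz loses no coefficient of a truncation. *)
Definition euler (a : fps) : fps := fun n => n%:R * a n.

Definition fps_deriv (a : fps) : fps := fun n => n.+1%:R * a n.+1.

Lemma represents_deriv N p a :
  represents N.+1 p a -> represents N p^`() (fps_deriv a).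
Proof. by move=> pa i le_iN; rewrite coef_deriv pa // -mulr_natl. Qed.

Lemma represents_euler N p a :
  represents N p a -> represents N ('X * p^`()) (euler a).
Proof.
move=> pa [|i] le_iN; rewrite coefXM /= /euler ?mul0r //.
by rewrite coef_deriv pa // mulr_natl.
Qed.

Lemma represents_leq M N p a : (M <= N)%N -> represents N p a -> represents M p a.
Proof. by move=> le_MN pa i le_iM; apply/pa/leq_trans/le_MN. Qed.

Lemma euler_comp a b :
  b 0%N = 0 -> euler (fps_comp a b) = fps_mul (fps_comp (fps_deriv a) b) (euler b).
Proof.
move=> b0; apply: fps_eq_poly => N.
(* One extra order compensates for the coefficient lost in [fps_deriv a]. *)
have ra := represents_truncate N.+1 a; have rb := represents_truncate N.+1 b.
exists ('X * (truncate N.+1 a \Po truncate N.+1 b)^`()).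
  by apply/represents_euler/(represents_leq N N.+1)/represents_comp.
rewrite deriv_comp mulrCA; apply: represents_mul.
  by apply: represents_comp; [|exact: represents_deriv|exact: represents_leq rb].
by apply/represents_euler/(represents_leq _ _ _ _ _ rb).
Qed.

Lemma euler_exp c f :
  f 0%N = 0 ->
  euler (fps_exp (fps_scale c f))
  = fps_scale c (fps_mul (euler f) (fps_exp (fps_scale c f))).
Proof.
move=> f0; rewrite fps_exp_scale euler_comp // fps_mulC -fps_scale_mull.
have -> : fps_deriv (exp_series c) = fps_scale c (exp_series c).
  apply: functional_extensionality => i.
  rewrite /fps_deriv /fps_scale /exp_series factS natrM exprS.
  have fact0 : i`!%:R != 0 :> rat by rewrite pnatr_eq0 -lt0n fact_gt0.
  by field; rewrite fact0 -[1 + _]/(1%:R + _) -natrD pnatr_eq0.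
by rewrite fps_comp_scale fps_mulC !fps_scale_mull fps_mulC.
Qed.

(** * Lagrange inversion *)

Lemma exp_of_changeE f : exp_of_change f = fps_mul fps_X (fps_exp f).
Proof. by apply: functional_extensionality => -[|n]; rewrite fps_mulX. Qed.

(** Inverse changes of variable have inverse exponentials. The condition [gf] says that g composed
    with phi = z exp(f) is -f, so the composite is phi exp(-f) = z. *)
Lemma exp_of_change_inverse f g :
  f 0%N = 0 -> change_inverse f g ->
  fps_comp (exp_of_change g) (exp_of_change f) = fps_X.
Proof.
move=> f0 [g0 _ gf]; have phi0 : exp_of_change f 0%N = 0 by [].
rewrite {1}exp_of_changeE fps_comp_mul // fps_comp_Xl // fps_exp_comp //.
have -> : fps_comp g (exp_of_change f) = fps_scale (-1) f.
  apply: functional_extensionality => n; have /eqP := gf n.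
  by rewrite /change_comp /fps_add addrC addr_eq0 /fps_scale mulN1r => /eqP.
rewrite exp_of_changeE -fps_mulA -{1}[f]fps_scale1 fps_exp_mul // subrr.
by rewrite fps_exp_scale0 // fps_mulC fps_mul1.
Qed.

Lemma one_plus_log_series a : one_plus a = fps_add fps_one (euler (log_series a)).
Proof.
apply: functional_extensionality => -[|d]; rewrite /fps_add /euler /= ?mul0r ?addr0 //.
by rewrite add0r mulrC divfK // pnatr_eq0.
Qed.

Lemma coef_one_plus_exp a r :
  fps_mul (one_plus a) (fps_exp (fps_scale (- r%:R) (log_series a))) r = (r == 0%N)%:R.
Proof.
case: r => [|r].
  by rewrite oppr0 fps_exp_scale0 // fps_mulC fps_mul1.
rewrite one_plus_log_series fps_mulDl fps_mul1 /fps_add.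
have r0 : r.+1%:R != 0 :> rat by rewrite pnatr_eq0.
(* For h = exp(-(r+1)f), the equation z h' = -(r+1) z f' h is read at z^{r+1}, where z h'
   contributes the same factor r+1, which cancels. *)
have := congr1 (fun h => h r.+1) (euler_exp (- r.+1%:R) (log_series a) erefl).
rewrite /euler /fps_scale mulNr -mulrN => /(mulfI r0) ->.
by rewrite addNr.
Qed.

Lemma coef_comp_mul a b c d :
  b 0%N = 0 ->
  fps_mul (fps_comp a b) c d = \sum_(j < d.+1) a j * fps_mul (fps_pow b j) c d.
Proof.
move=> b0; rewrite /fps_mul.
transitivity (\sum_(i < d.+1) \sum_(j < d.+1) a j * fps_pow b j i * c (d - i)%N).
  apply: eq_bigr => i _.
  by rewrite (fps_comp_widen _ _ _ d) ?mulr_suml // -ltnS ltn_ord.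
rewrite exchange_big; apply: eq_bigr => j _; rewrite mulr_sumr.
by apply: eq_bigr => i _; rewrite mulrA.
Qed.

Lemma lagrange_inversion a B xi d :
  change_inverse (log_series a) xi ->
  fps_div (fps_comp B (exp_of_change xi))
          (fps_comp (one_plus a) (exp_of_change xi)) d
  = fps_mul B (fps_exp (fps_scale (- d%:R) (log_series a))) d.
Proof.
set f := log_series a; set A := one_plus a => inv_xi.
set G := fps_div _ _; set phi := exp_of_change f.
have phi0 : phi 0%N = 0 by []; have psi0 : exp_of_change xi 0%N = 0 by [].
have f0 : f 0%N = 0 by [].
(* Composing with phi undoes the composition with its inverse, so it suffices to clear the
   denominator in [G], whose constant term is 1. *)
have def_B : B = fps_mul (fps_comp G phi) A.
  have psi_phi C : fps_comp (fps_comp C (exp_of_change xi)) phi = C.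
    by rewrite fps_compA // exp_of_change_inverse // fps_comp_Xr.
  rewrite -[A]psi_phi -fps_comp_mul // -[LHS]psi_phi; congr fps_comp.
  rewrite /G /fps_div -fps_mulA fps_mul_inv; first by rewrite fps_mulC fps_mul1.
  by rewrite /fps_comp big_ord1 mul1r oner_eq0.
rewrite [in RHS]def_B -fps_mulA coef_comp_mul //.
(* As phi^j = z^j exp(jf), this is the coefficient of z^{d-j} in A exp(-(d-j)f), to which
   [coef_one_plus_exp] applies. *)
have coef_phi j : (j <= d)%N ->
    fps_mul (fps_pow phi j) (fps_mul A (fps_exp (fps_scale (- d%:R) f))) d
    = (d - j == 0)%N%:R.
  move=> le_jd; rewrite -(coef_one_plus_exp a) -/f -/A /phi exp_of_changeE.
  rewrite fps_pow_mul fps_exp_pow // -fps_mulA fps_mul_powX ltnNge le_jd /=.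
  rewrite fps_mulC -fps_mulA fps_exp_mul //.
  by rewrite natrB // opprB [- _ + _]addrC.
rewrite big_ord_recr /= big1 ?add0r => [|j _].
  by rewrite coef_phi // subnn mulr1.
by rewrite coef_phi 1?ltnW // subn_eq0 leqNgt ltn_ord mulr0.
Qed.

Theorem theorem2 (L : constants) (higher : nat -> relation) (k : nat) (xi : fps)
  (L_stable : stable_range L k)
  (higher_homogeneous : forall d : nat, (4 <= d)%N -> homogeneous d (higher d))
  (xi_inverse : change_inverse (mirror_map L higher k) xi)
  (n : nat) (n_ge2 : (2 <= n)%N) (n_le : (n + 3 <= k)%N) :
  mirror_transformation L higher k xi n <->
  forall d : nat, (1 <= d)%N ->
    L k k d n%:Z =
      \sum_(0 <= m < d)
        fps_exp (fps_scale (- d%:R)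
                   (log_series (fun j => virtual L higher k k j 1))) m
        * (virtual L higher k k (d - m)%N n%:Z
           - virtual L higher k k (d - m)%N 1).
Proof.
pose a j := virtual L higher k k j 1; pose b j := virtual L higher k k j n%:Z.
pose E d := fps_exp (fps_scale (- d%:R) (log_series a)).
pose rhs d := fps_div (fps_comp (one_plus b) (exp_of_change xi))
                (fps_comp (one_plus a) (exp_of_change xi)) d.
have rhsE d : rhs d = fps_mul (one_plus b) (E d) d by apply: lagrange_inversion.
(* The mirror transformation also has a degree 0 coefficient, about which the explicit formula is
   silent. *)
have rhs0 : rhs 0%N = 1.
  by rewrite rhsE /fps_mul big_ord1 mul1r /E oppr0 fps_exp_scale0.
have rhs_gt0 d : (1 <= d)%N ->
    rhs d = \sum_(0 <= m < d) E d m * (b (d - m)%N - a (d - m)%N).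
  move=> d_gt0; rewrite rhsE.
  (* This vanishing coefficient is subtracted to turn b into b - a. *)
  have A_E0 : fps_mul (one_plus a) (E d) d = 0.
    by rewrite coef_one_plus_exp; case: (d) d_gt0.
  rewrite -[LHS]subr0 -[X in _ - X]A_E0.
  (* In the term m = d both constant coefficients are 1 and cancel; for m < d the index d - m is
     positive, so [one_plus] returns [b] and [a] themselves. *)
  rewrite ![fps_mul (one_plus _) _]fps_mulC /fps_mul -sumrB big_ord_recr /=.
  rewrite subnn subrr addr0 big_mkord; apply: eq_bigr => m _.
  rewrite -mulrBr; case def_r: (d - m)%N => [|r] //=.
  by move/eqP: def_r; rewrite subn_eq0 leqNgt ltn_ord.
have eq_mirror : mirror_transformation L higher k xi n
    <-> (forall d, one_plus (fun d' => L k k d' n%:Z) d = rhs d) by [].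
rewrite eq_mirror; split=> [eqL d d_gt0 | eqL [|d]].
- by rewrite -rhs_gt0 // -eqL; case: (d) d_gt0.
- by rewrite rhs0.
- by rewrite rhs_gt0 //= eqL.
Qed.
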